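(* Let $r,p,n$ be positive integers with $p\mid r$ and $d:=r/p$. Then, as formal power series in $t$ and $q$, $$\sum_{k\ge 0}[k+1]_q^n\,t^k=\frac{\displaystyle\sum_{h\in G(r,p,n)}t^{\mathrm{fdes}(h)}q^{\mathrm{fmaj}(h)}}{(1-t)(1-t^rq^r)(1-t^rq^{2r})\cdots(1-t^rq^{(n-1)r})(1-t^dq^{nd})}.$$
   Context: $[k+1]_q=1+q+\cdots+q^k$. $G(r,n)=\mathbb{Z}_r\wr S_n$ is the set of pairs $((c_1,\dots,c_n),\sigma)$ with $c_i\in\{0,\dots,r-1\}$, $\sigma\in S_n$; $G(r,p,n)$ is the subgroup of those with $\sum_i c_i\equiv0 \bmod p$. Let $\Gamma=\{((c_1,\dots,c_n),\sigma)\in G(r,n): c_n<d\}$. For $\gamma=((c_1,\dots,c_n),\sigma)\in\Gamma$ write $\gamma_i=\sigma(i)^{c_i}$ (the integer $\sigma(i)$ with color $c_i$). Colored integers are totally ordered by $j^{c}\prec k^{c'}$ iff $c>c'$, or $c=c'$ and $j<k$. Put $\mathrm{Des}(\gamma)=\{i\in\{1,\dots,n-1\}:\gamma_i\succ\gamma_{i+1}\}$, and $$\mathrm{fmaj}(\gamma)=r\sum_{i\in\mathrm{Des}(\gamma)}i+\sum_{i=1}^n c_i,\qquad \mathrm{fdes}(\gamma)=r\,|\mathrm{Des}(\gamma)|+c_1.$$ The map $\varphi:G(r,p,n)\to\Gamma$, $((c_1,\dots,c_{n-1},c_n),\sigma)\mapsto((c_1,\dots,c_{n-1},\lfloor c_n/p\rfloor),\sigma)$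 is a bijection, and for $h\in G(r,p,n)$ one sets $\mathrm{fmaj}(h):=\mathrm{fmaj}(\varphi(h))$ and $\mathrm{fdes}(h):=\mathrm{fdes}(\varphi(h))$. *)

(* Defs.v *)
From HB Require Import structures.
From mathcomp Require Import all_boot all_order all_fingroup all_algebra.
From mathcomp Require Import boolp.

Set Implicit Arguments.
Unset Strict Implicit.
Unset Printing Implicit Defensive.

Import GRing.Theory.
Local Open Scope ring_scope.

(* Formal power series in one variable.  [Fps f] is the series               *)
(* f 0 + f 1 * 'x + f 2 * 'x^2 + ...; power series in two variables t and q  *)
(* are series in t whose coefficients are series in q, i.e. [fps (fps R)].   *)

Record fps (R : Type) := Fps { fps_coef :> nat -> R }.

HB.instance Definition _ R := [isNew for @fps_coef R].
HB.instance Definition _ (R : eqType) := [Equality of fps R by <:].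
HB.instance Definition _ (R : choiceType) := [Choice of fps R by <:].

Lemma fpsP R (f g : fps R) : (forall k, f k = g k) -> f = g.
Proof. by case: f g => f [g] /= fg; congr Fps; apply: funext. Qed.

Section FpsZmodule.
Variable R : zmodType.
Implicit Types f g h : fps R.

Definition fps_zero : fps R := Fps (fun _ => 0).
Definition fps_opp f : fps R := Fps (fun k => - f k).
Definition fps_add f g : fps R := Fps (fun k => f k + g k).

Fact fps_addA : associative fps_add.
Proof. by move=> f g h; apply: fpsP => k; apply: addrA. Qed.

Fact fps_addC : commutative fps_add.
Proof. by move=> f g; apply: fpsP => k; apply: addrC. Qed.

Fact fps_add0 : left_id fps_zero fps_add.
Proof. by move=> f; apply: fpsP => k; apply: add0r. Qed.

Fact fps_addN : left_inverse fps_zero fps_opp fps_add.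
Proof. by move=> f; apply: fpsP => k; apply: addNr. Qed.

HB.instance Definition _ :=
  GRing.isZmodule.Build (fps R) fps_addA fps_addC fps_add0 fps_addN.

End FpsZmodule.

Section FpsRing.
Variable R : comNzRingType.
Implicit Types f g h : fps R.

Definition fpsC (a : R) : fps R := Fps (fun k => if k == 0%N then a else 0).
Definition fpsX : fps R := Fps (fun k => (k == 1%N)%:R).
Definition fps_mul f g : fps R :=
  Fps (fun k => \sum_(i < k.+1) f i * g (k - i)%N).

Let trunc f n : {poly R} := \poly_(i < n) f i.

Let coef_fps_mul f g k n :
  (k < n)%N -> fps_mul f g k = (trunc f n * trunc g n)`_k.
Proof.
move=> lt_kn; rewrite coefM; apply: eq_bigr => i _.
rewrite !coef_poly (leq_ltn_trans (leq_ord i) lt_kn).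
by rewrite (leq_ltn_trans (leq_subr _ _) lt_kn).
Qed.

Fact fps_mulC : commutative fps_mul.
Proof.
by move=> f g; apply: fpsP => k; rewrite !(coef_fps_mul _ _ (ltnSn k)) mulrC.
Qed.

Let coef_fps_mul3 f g h k :
  fps_mul (fps_mul f g) h k =
  (trunc f k.+1 * trunc g k.+1 * trunc h k.+1)`_k.
Proof.
rewrite coefM; apply: eq_bigr => i _.
by rewrite (coef_fps_mul _ _ (ltn_ord i)) coef_poly ltnS leq_subr.
Qed.

Fact fps_mulA : associative fps_mul.
Proof.
move=> f g h; rewrite (fps_mulC f); apply: fpsP => k.
by rewrite !coef_fps_mul3 -[in RHS]mulrA mulrC.
Qed.

Fact fps_mul1 : left_id (fpsC 1) fps_mul.
Proof.
move=> f; apply: fpsP => k /=.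
rewrite big_ord_recl /= subn0 mul1r big1 ?addr0 // => i _.
by rewrite /= mul0r.
Qed.

Fact fps_mulDl : left_distributive fps_mul +%R.
Proof.
move=> f g h; apply: fpsP => k /=.
by rewrite -big_split; apply: eq_bigr => i _; rewrite mulrDl.
Qed.

Fact fps_one_neq0 : fpsC 1 != 0 :> fps R.
Proof.
apply/eqP => /(congr1 (fun f : fps R => f 0%N)) /= /eqP.
by rewrite oner_eq0.
Qed.

HB.instance Definition _ :=
  GRing.Zmodule_isComNzRing.Build (fps R)
    fps_mulA fps_mulC fps_mul1 fps_mulDl fps_one_neq0.

Lemma fps_coefM f g k : (f * g) k = \sum_(i < k.+1) f i * g (k - i)%N.
Proof. by []. Qed.

Lemma fps_coef1 k : (1 : fps R) k = (k == 0%N)%:R.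
Proof. by rewrite /=; case: eqP. Qed.

End FpsRing.

Section FpsUnitRing.
Variable R : comUnitRingType.
Implicit Types f g h : fps R.

Definition fps_unit : pred (fps R) := [pred f : fps R | f 0%N \is a GRing.unit].

(* The first n coefficients of 1 / f, for f with invertible constant term,   *)
(* obtained by solving f * g = 1 coefficient by coefficient.                 *)
Fixpoint fps_inv_coefs f n : seq R :=
  if n is n'.+1 then
    let s := fps_inv_coefs f n' in
    rcons s ((f 0%N)^-1 *
             ((n' == 0%N)%:R - \sum_(i < n') f i.+1 * s`_(n' - i.+1)))
  else [::].

Definition fps_inv f : fps R :=
  if f \in fps_unit then Fps (fun k => (fps_inv_coefs f k.+1)`_k) else f.

Let size_inv_coefs f n : size (fps_inv_coefs f n) = n.
Proof. by elim: n => //= n IHn; rewrite size_rcons IHn. Qed.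

Let nth_inv_coefs f n k :
  (k < n)%N -> (fps_inv_coefs f n)`_k = (fps_inv_coefs f k.+1)`_k.
Proof.
elim: n => // n IHn; rewrite ltnS leq_eqVlt => /orP[/eqP-> //|lt_kn].
by rewrite [fps_inv_coefs f n.+1]/= nth_rcons size_inv_coefs lt_kn IHn.
Qed.

Fact fps_mulVf : {in fps_unit, left_inverse 1 fps_inv *%R}.
Proof.
move=> f Uf; rewrite mulrC; apply: fpsP => k.
rewrite fps_coefM fps_coef1 big_ord_recl subn0 /fps_inv Uf.
rewrite [Fps _ k]/= nth_rcons size_inv_coefs ltnn eqxx mulVKr //.
rewrite -[RHS](subrK (\sum_(i < k) f i.+1 * (fps_inv_coefs f k)`_(k - i.+1))).
congr (_ + _); apply: eq_bigr => i _ /=.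
have ltk : (k - i.+1 < k)%N by rewrite ltn_subrL /= (leq_ltn_trans _ (ltn_ord i)).
by rewrite (nth_inv_coefs _ ltk) /bump /= add1n.
Qed.

Fact fps_unitPl f g : g * f = 1 -> f \in fps_unit.
Proof.
move=> /(congr1 (fun f : fps R => f 0%N)).
rewrite fps_coefM big_ord_recl big_ord0 addr0 subn0 => gf1.
by apply/unitrPr; exists (g 0%N); rewrite mulrC.
Qed.

Fact fps_inv_out : {in [predC fps_unit], fps_inv =1 id}.
Proof. by move=> f /negPf nUf; rewrite /fps_inv nUf. Qed.

HB.instance Definition _ :=
  GRing.ComNzRing_hasMulInverse.Build (fps R)
    fps_mulVf fps_unitPl fps_inv_out.

Lemma fps_unitE f : (f \is a GRing.unit) = (f 0%N \is a GRing.unit).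
Proof. by []. Qed.

End FpsUnitRing.

Definition fps2 : comUnitRingType := fps (fps int).
Definition fps_t : fps2 := fpsX (fps int).
Definition fps_q : fps2 := fpsC (fpsX int).

(* [m]_q = 1 + q + ... + q^(m-1) *)
Definition qint (m : nat) : fps int := \sum_(i < m) fpsX int ^+ i.

(* Colored permutations.  Positions and values 1, ..., n+1 of the usual      *)
(* notation are the ordinals 0, ..., n of 'I_n.+1, so that the first and     *)
(* last colors are those at [ord0] and [ord_max].                            *)

Definition colored_perm (r n : nat) : finType :=
  ({ffun 'I_n -> 'I_r} * 'S_n)%type.

Section ColoredPerm.
Local Open Scope nat_scope.
Variables r p n : nat.
Implicit Types g h : colored_perm r n.+1.

Definition color g (i : 'I_n.+1) : nat := g.1 i.

(* the colored integer j^c is the pair (j, c) *)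
Definition entry g (i : 'I_n.+1) : nat * nat := ((g.2 i).+1, color g i).

Definition cprec (x y : nat * nat) : bool :=
  (x.2 > y.2) || (x.2 == y.2) && (x.1 < y.1).

(* i : 'I_n stands for the position i+1, in {1, ..., n}; [inord i] and       *)
(* [inord i.+1] are the positions i+1 and i+2 among {1, ..., n+1}            *)
Definition Des g : {set 'I_n} :=
  [set i : 'I_n | cprec (entry g (inord i.+1)) (entry g (inord i))].

Definition fmaj_Gamma g : nat :=
  r * (\sum_(i in Des g) i.+1) + \sum_(i < n.+1) color g i.

Definition fdes_Gamma g : nat := r * #|Des g| + color g ord0.

Definition Grpn : {set colored_perm r n.+1} :=
  [set h : colored_perm r n.+1 | \sum_(i < n.+1) color h i == 0 %[mod p]].

Definition Gamma : {set colored_perm r n.+1} :=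
  [set g : colored_perm r n.+1 | color g ord_max < r %/ p].

Definition divn_ord (c : 'I_r) : 'I_r :=
  Ordinal (leq_ltn_trans (leq_div c p) (ltn_ord c)).

Definition phi h : colored_perm r n.+1 :=
  ([ffun i => if i == ord_max then divn_ord (h.1 i) else h.1 i], h.2).

Definition fmaj h : nat := fmaj_Gamma (phi h).
Definition fdes h : nat := fdes_Gamma (phi h).

Lemma phi_inj : {in Grpn &, injective phi}.
Proof.
move=> [c s] [c' s']; rewrite !inE /color /= => /eqP Sc /eqP Sc'.
case=> /ffunP eq_c <-; congr (_, _); apply/ffunP=> i.
have eq_lt (j : 'I_n) :
    c (widen_ord (leqnSn n) j) = c' (widen_ord (leqnSn n) j).
  have := eq_c (widen_ord (leqnSn n) j); rewrite !ffunE.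
  by rewrite -val_eqE /= ltn_eqF.
case: (unliftP ord_max i) => [j|] ->; last first.
  have := eq_c ord_max; rewrite !ffunE eqxx => /(congr1 val) /= eq_d.
  apply: val_inj; rewrite /= (divn_eq (c ord_max) p) (divn_eq (c' ord_max) p).
  rewrite eq_d; congr (_ + _); move: Sc; rewrite -Sc' !big_ord_recr /=.
  under eq_bigr do rewrite eq_lt.
  by move/eqP; rewrite eqn_modDl => /eqP.
suff -> : lift ord_max j = widen_ord (leqnSn n) j by [].
by apply: val_inj; rewrite /= /bump leqNgt ltn_ord.
Qed.

Lemma phi_Grpn : 0 < p -> p %| r -> phi @: Grpn = Gamma.
Proof.
move=> p_gt0 p_dvd_r; apply/setP=> g; apply/imsetP/idP.
  case=> h _ ->; rewrite inE /color ffunE eqxx /= ltn_divLR //.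
  by rewrite divnK.
rewrite inE => lt_g.
pose S := \sum_(i < n) color g (widen_ord (leqnSn n) i).
pose b := (p - S %% p) %% p.
have lt_bp : b < p by rewrite ltn_mod.
have lt_cr : color g ord_max * p + b < r.
  have : (color g ord_max).+1 * p <= r %/ p * p by rewrite leq_mul2r lt_g orbT.
  by rewrite divnK //; apply: leq_trans; rewrite mulSn addnC ltn_add2r.
pose h : colored_perm r n.+1 :=
  ([ffun i => if i == ord_max then Ordinal lt_cr else g.1 i], g.2).
exists h.
  rewrite inE /color big_ord_recr /= ffunE eqxx /=.
  have -> : \sum_(i < n) h.1 (widen_ord (leqnSn n) i) = S.
    apply: eq_bigr => i _; rewrite ffunE ifF //.
    by rewrite -val_eqE /= ltn_eqF.
  rewrite addnCA mod0n modnMDl /b modnDmr -modnDml subnKC ?modnn //.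
  by rewrite ltnW ?ltn_mod.
rewrite [LHS]surjective_pairing /phi /h /=.
congr (_, _); apply/ffunP=> i; rewrite !ffunE; case: eqP => // ->.
by apply: val_inj; rewrite /= divnMDl // divn_small ?addn0.
Qed.

End ColoredPerm.

(* Main.v *)
Require Import Defs.
From mathcomp Require Import all_boot all_order all_fingroup all_algebra.
From mathcomp Require Import zify.
Import GRing.Theory.
Local Open Scope ring_scope.
Set Implicit Arguments.
Unset Strict Implicit.
Unset Printing Implicit Defensive.

(** Put N = n + 1 and y_i = t q^i.  Both sides are computed separately for each
permutation s, with delta_i = 1 if s descends at i and 0 otherwise.

On the left, the coefficient of t^k counts the words f in {0, ..., k}^N by
their sum.  Each word is sorted into weakly decreasing order by a unique s,
once ties are broken by increasing index: f o s is then a chain that drops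
strictly at the descents of s ([sum_sorts]).  Summing the chains attached to s
one entry at a time, from the largest one down, meets a geometric series of
ratio y_i at the i-th entry; this gives Carlitz's identity ([carlitz])

    sum_k [k+1]^N t^k = sum_s prod_{0<i<N} y_i^{delta_i} / prod_{i<=N} (1 - y_i).

On the right, summation by parts ([weight_colored_perm]) writes the weight of
a colored permutation (c, s) as

    t^fdes q^fmaj = prod_{0<i<N} y_i^(r D_i + c_i - c_{i+1}) * y_N^(c_N),

D_i telling whether (c, s) descends at i.  For fixed s and c_{i+1}, the exponent
r D_i + c_i - c_{i+1} takes the values delta_i, ..., delta_i + r - 1 once each
as c_i varies ([sum_cyclic_shift]).  So the sum over c_1 does not depend on
c_2, then the sum over c_2 does not depend on c_3, and so on: the sum over all
colors with c_N < d is
prod_{0<i<N} y_i^{delta_i} (1 - y_i^r)/(1 - y_i) * (1 - y_N^d)/(1 - y_N)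
([sum_colors]).  Since y_i^r = t^r q^(ir), dividing by the denominator of the
theorem gives the s-term of Carlitz's identity.

Both eliminations are instances of a transfer lemma, [sum_path]. *)

(** * Sums over paths *)

Lemma big_ffun_ord_recr (R : Type) (idx : R) (op : Monoid.com_law idx)
    (T : finType) n (F : {ffun 'I_n.+1 -> T} -> T -> R) :
  \big[op/idx]_(f : {ffun 'I_n.+2 -> T})
     F [ffun i => f (widen_ord (leqnSn n.+1) i)] (f ord_max) =
  \big[op/idx]_(f : {ffun 'I_n.+1 -> T}) \big[op/idx]_(y : T) F f y.
Proof.
rewrite pair_bigA /=.
pose glue (p : {ffun 'I_n.+1 -> T} * T) : {ffun 'I_n.+2 -> T} :=
  [ffun i => if unlift ord_max i is Some j then p.1 j else p.2].
pose cut (f : {ffun 'I_n.+2 -> T}) :=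
  ([ffun i => f (widen_ord (leqnSn n.+1) i)], f ord_max).
have widenE (i : 'I_n.+1) : widen_ord (leqnSn n.+1) i = lift ord_max i.
  by apply: val_inj; rewrite /= /bump leqNgt ltn_ord.
have glueK : cancel glue cut.
  case=> f y; rewrite /cut ffunE unlift_none; congr (_, _).
  by apply/ffunP=> i; rewrite !ffunE widenE liftK.
have cutK : cancel cut glue.
  move=> f; apply/ffunP=> i; rewrite ffunE.
  by case: unliftP => [j ->|->] //=; rewrite ffunE widenE.
rewrite (reindex glue) /=; last by exists cut => ? _; rewrite ?cutK ?glueK.
by apply: eq_bigr => -[f y] _; have [-> ->] := glueK (f, y).
Qed.

(** The transfer-matrix method: in a sum over all f(0), ..., f(n) of a product
of weights of consecutive pairs, f(0), f(1), ... are summed out in turn;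
[phi i y] is what has been collected when f(i) = y. *)
Lemma sum_path (R : comNzRingType) (T : finType) n
    (M : nat -> T -> T -> R) (phi : nat -> T -> R) (w : T -> R) :
    phi 0%N =1 (fun=> 1) ->
    (forall i y, (i < n)%N -> \sum_x phi i x * M i x y = phi i.+1 y) ->
  \sum_(f : {ffun 'I_n.+1 -> T})
     (\prod_(i < n) M i (f (inord i)) (f (inord i.+1))) * w (f ord_max) =
  \sum_y phi n y * w y.
Proof.
move=> phi0; elim: n w => [|n IHn] w phiS.
  rewrite (reindex (fun y => [ffun _ : 'I_1 => y])) /=; last first.
    exists (fun f : {ffun 'I_1 -> T} => f ord0) => [y _|f _].
      by rewrite ffunE.
    by apply/ffunP=> i; rewrite ffunE (ord1 i).
  by apply: eq_bigr => y _; rewrite big_ord0 ffunE phi0.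
transitivity (\sum_(f : {ffun 'I_n.+1 -> T}) \sum_y
    (\prod_(i < n) M i (f (inord i)) (f (inord i.+1))) * (M n (f ord_max) y * w y)).
  rewrite -big_ffun_ord_recr; apply: eq_bigr => f _.
  rewrite big_ord_recr /= -!mulrA; congr (_ * (M n _ (f _) * _)).
  - apply: eq_bigr => i _; rewrite !ffunE.
    congr (M i (f _) (f _)); apply: val_inj; have := ltn_ord i => lt_in;
      by rewrite /= !inordK; lia.
  - by rewrite ffunE; congr (f _); apply: val_inj; rewrite /= inordK.
  - by apply: val_inj; rewrite /= inordK.
under eq_bigr do rewrite -mulr_sumr.
rewrite (IHn (fun x => \sum_y M n x y * w y)); last first.
  by move=> i y lt_in; apply: phiS; apply: ltnW.
under eq_bigr do rewrite mulr_sumr.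
rewrite exchange_big; apply: eq_bigr => y _.
by rewrite -phiS // mulr_suml; apply: eq_bigr => x _; rewrite mulrA.
Qed.

(** * Sorting a word by a permutation *)

Section Sorting.
Variable n : nat.

Definition descent (s : 'S_n.+1) (i : nat) : bool :=
  (s (inord i.+1) < s (inord i))%N.

(** A weakly decreasing f o s whose ties occur only at ascents of s.  Truth values
add as 0 and 1, so a descent of s forces a strict drop. *)
Definition sorts (f : 'I_n.+1 -> nat) (s : 'S_n.+1) : bool :=
  [forall i : 'I_n, f (s (inord i.+1)) + descent s i <= f (s (inord i))]%N.

(** To say that s sorts f is to say that s lists the indices in the strict total
order which compares them by decreasing value of f, then increasing index; a
finite set has exactly one such listing. *)
Lemma exists1_sorts (f : 'I_n.+1 -> nat) :
  exists s0, forall s, sorts f s = (s == s0).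
Proof.
pose before (x y : 'I_n.+1) := (f y < f x)%N || (f x == f y) && (x < y)%N.
have before_irr : irreflexive before by move=> x; rewrite /before; lia.
have before_tr : transitive before by move=> y x z; rewrite /before; lia.
pose eqbefore x y := ~~ before y x.
have eqbefore_tot : total eqbefore by move=> x y; rewrite /eqbefore /before; lia.
have eqbefore_tr : transitive eqbefore.
  by move=> y x z; rewrite /eqbefore /before; lia.
pose word (s : 'S_n.+1) := [seq s i | i <- enum 'I_n.+1].
have nth_word s i : (i < n.+1)%N -> nth ord0 (word s) i = s (inord i).
  move=> lt_in; rewrite (nth_map ord0) ?size_enum_ord //; congr (s _).
  by apply: val_inj; rewrite /= nth_enum_ord // inordK.
have sortsE s : sorts f s = sorted before (word s).
  apply/forallP/(sortedP ord0) => [Hs i|Hs i].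
    rewrite size_map size_enum_ord ltnS => lt_in.
    rewrite !nth_word ?ltnS // 1?ltnW //.
    have := Hs (Ordinal lt_in); rewrite /before /descent /=.
    have : s (inord i) != s (inord i.+1) :> nat.
      rewrite (inj_eq val_inj) (inj_eq perm_inj) -val_eqE /= !inordK //; lia.
    lia.
  have := Hs i; rewrite size_map size_enum_ord ltnS ltn_ord => /(_ isT).
  rewrite !nth_word ?ltnS ?(ltnW (ltn_ord i)) ?ltn_ord // /before /descent.
  lia.
have /tuple_permP[s0 s0E] : perm_eq (sort eqbefore (enum 'I_n.+1)) (ord_tuple n.+1).
  by rewrite val_ord_tuple perm_sort.
have {}s0E : sort eqbefore (enum 'I_n.+1) = word s0.
  by rewrite s0E /=; apply: eq_map => i; rewrite tnth_ord_tuple.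
have uniq_word s : uniq (word s) by rewrite map_inj_uniq ?enum_uniq //; apply: perm_inj.
have sorted0 : sorted before (word s0).
  have Hs : sorted eqbefore (word s0) by rewrite -s0E sort_sorted.
  apply/(sortedP ord0) => i lt_i.
  have := sorted_ltn_nth eqbefore_tr ord0 Hs.
  move=> /(_ i i.+1); rewrite !inE lt_i (ltnW lt_i) ltnSn => /(_ isT isT isT).
  have : nth ord0 (word s0) i != nth ord0 (word s0) i.+1.
    by rewrite nth_uniq ?(ltnW lt_i) // neq_ltn ltnSn.
  rewrite /eqbefore /before -val_eqE /=; lia.
exists s0 => s; rewrite sortsE; apply/idP/eqP => [sorted_s|-> //].
have /eq_in_map eq_word : word s = word s0.
  apply: (irr_sorted_eq before_tr before_irr) => // x.
  have mem_word s' : x \in word s'.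
    by apply/mapP; exists ((s'^-1)%g x); rewrite ?mem_enum ?permKV.
  by rewrite !mem_word.
by apply/permP=> i; apply: eq_word; rewrite mem_enum.
Qed.

Lemma sum_sorts (R : comNzRingType) (f : 'I_n.+1 -> nat) :
  \sum_(s : 'S_n.+1) \prod_(i < n)
     (f (s (inord i.+1)) + descent s i <= f (s (inord i)))%N%:R = 1 :> R.
Proof.
have prod_sorts (s : 'S_n.+1) : \prod_(i < n)
     (f (s (inord i.+1)) + descent s i <= f (s (inord i)))%N%:R = (sorts f s)%:R :> R.
  rewrite /sorts; case: forallP => [Hs|].
    by rewrite big1 // => i _; rewrite Hs.
  move=> /forallP; rewrite negb_forall => /existsP[i /negPf Hi].
  by rewrite (bigD1 i) //= Hi mul0r.
have [s0 s0P] := exists1_sorts f.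
under eq_bigr do rewrite prod_sorts s0P.
by rewrite (bigD1 s0) //= eqxx big1 ?addr0 // => s /negPf->.
Qed.

End Sorting.

(** * Coefficients of power series *)

Section Series.
Variable R : comUnitRingType.
Implicit Types f g : fps R.

Lemma fps_coefD f g k : (f + g) k = f k + g k.
Proof. by []. Qed.

Lemma fps_coef_sum I (s : seq I) (P : pred I) (F : I -> fps R) k :
  (\sum_(i <- s | P i) F i) k = \sum_(i <- s | P i) F i k.
Proof. exact: (big_morph (fun f : fps R => f k)). Qed.

Lemma fps_coef_Cmul (a : R) f k : (fpsC a * f) k = a * f k.
Proof.
rewrite fps_coefM big_ord_recl subn0 /= big1 ?addr0 // => i _.
by rewrite mul0r.
Qed.

Lemma fpsC_exp (a : R) m : fpsC a ^+ m = fpsC (a ^+ m).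
Proof.
elim: m => // m IHm; rewrite !exprS IHm; apply: fpsP => k.
by rewrite fps_coef_Cmul /=; case: eqP => //; rewrite mulr0.
Qed.

Lemma fps_coef_Xmul f k : (fpsX R * f) k = if k is k'.+1 then f k' else 0.
Proof.
rewrite fps_coefM big_ord_recl subn0 /= mul0r add0r.
case: k => [|k]; first by rewrite big_ord0.
rewrite big_ord_recl /= mul1r subSS subn0 big1 ?addr0 // => i _.
by rewrite /= mul0r.
Qed.

Lemma fps_coef_Xexp_mul f m k :
  (fpsX R ^+ m * f) k = if (m <= k)%N then f (k - m)%N else 0.
Proof.
elim: m k => [|m IHm] k; first by rewrite mul1r subn0.
by rewrite exprS -mulrA fps_coef_Xmul; case: k => [|k]; rewrite // IHm.
Qed.

Lemma unit_1subXM g : 1 - fpsX R * g \is a GRing.unit.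
Proof.
rewrite fps_unitE; have -> : (1 - fpsX R * g) 0%N = 1 - (fpsX R * g) 0%N by [].
by rewrite fps_coef_Xmul subr0 unitr1.
Qed.

(** The part of the geometric series y^a f + y^(a+1) f + ... that contributes to
the coefficient of t^k is finite, because y is a multiple of t; infinite
summation is thereby avoided. *)
Lemma coef_geometric g f a k :
  \sum_(b < k.+1) (a <= b)%N%:R * ((fpsX R * g) ^+ b * f) k =
  ((fpsX R * g) ^+ a / (1 - fpsX R * g) * f) k.
Proof.
set y := fpsX R * g.
have U : 1 - y \is a GRing.unit := unit_1subXM g.
have vanish h m : (k < m)%N -> (y ^+ m * h) k = 0.
  by move=> lt_km; rewrite exprMn -mulrA fps_coef_Xexp_mul leqNgt lt_km.
case: (leqP a k.+1) => [le_ak|lt_ka]; last first.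
  rewrite -mulrA vanish 1?ltnW // big1 // => b _.
  by rewrite leqNgt (leq_trans (ltn_ord b) (ltnW lt_ka)) mul0r.
have geo : y ^+ a / (1 - y) = \sum_(a <= b < k.+1) y ^+ b + y ^+ k.+1 / (1 - y).
  apply: (mulIr U); rewrite mulrDl !mulrVK // mulrC mulr_sumr.
  rewrite (eq_bigr (fun b => - (y ^+ b.+1 - y ^+ b))); last first.
    by move=> b _; rewrite mulrBl mul1r -exprS opprB.
  by rewrite sumrN telescope_sumr // opprB subrK.
rewrite geo mulrDl -mulrA fps_coefD vanish // addr0 mulr_suml fps_coef_sum.
rewrite big_geq_mkord [RHS]big_mkcond; apply: eq_bigr => b _ /=.
by case: leq; rewrite ?mul1r ?mul0r.
Qed.

End Series.

(** * Carlitz's identity *)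

Section Carlitz.
Variables (R : comUnitRingType) (q : R) (n : nat).
Let y (i : nat) : fps R := fpsX R * fpsC q ^+ i.

(** The generating function of the chains k >= f(0) >= f(1) >= ... >= f(n) that
drop by at least [delta i] from f(i) to f(i + 1).  Summing over the largest
entry f(0) above f(1), and over the slack k - f(0), yields a constant times
y_1^f(1); each further entry adds q^f(i) to the summand, turning y_i^f(i) into
y_(i+1)^f(i), and the next geometric sum has ratio y_(i+1). *)
Lemma sum_chains (delta : nat -> bool) k :
  \sum_(f : {ffun 'I_n.+1 -> 'I_k.+1})
     (\prod_(i < n) ((f (inord i.+1) + delta i <= f (inord i))%N%:R *
                     q ^+ f (inord i))) * q ^+ f ord_max =
  ((\prod_(i < n) y i.+1 ^+ delta i) * \prod_(i < n.+2) (1 - y i)^-1) k.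
Proof.
(* [y i ^+ b * C i] is the generating function of the part of the chain that
   precedes the entry f(i) = b. *)
pose C i := (\prod_(j < i) y j.+1 ^+ delta j) * \prod_(j < i.+1) (1 - y j)^-1.
pose phi i (b : 'I_k.+1) := (y i ^+ b * C i) k.
pose M i (x z : 'I_k.+1) := (z + delta i <= x)%N%:R * q ^+ x : R.
have qphi i (x : 'I_k.+1) : phi i x * q ^+ x = (y i.+1 ^+ x * C i) k.
  rewrite /phi mulrC -fps_coef_Cmul -fpsC_exp mulrA -exprMn.
  by have -> : fpsC q * y i = y i.+1 by rewrite /y mulrCA -exprS.
transitivity (\sum_x phi n x * q ^+ x); last first.
  under eq_bigr do rewrite qphi.
  transitivity ((y n.+1 ^+ 0 / (1 - y n.+1) * C n) k).
    by rewrite -coef_geometric; apply: eq_bigr => b _; rewrite mul1r.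
  congr (fps_coef _ k).
  by rewrite expr0 mul1r /C [in RHS](big_ord_recr n.+1) /= mulrC -mulrA.
apply: (sum_path (M := M) (fun x : 'I_k.+1 => q ^+ x)) => [b|i z lt_in].
  have -> : phi 0%N b = (y 0%N ^+ b / (1 - y 0%N) * 1) k.
    by rewrite /phi /C big_ord0 big_ord_recl big_ord0 mul1r !mulr1.
  rewrite -coef_geometric (bigD1 ord_max) // big1 => [|x].
    by rewrite [LHS]addr0 -ltnS ltn_ord expr0 !mulr1 mul1r -[_ ^+ _]mulr1
      fps_coef_Xexp_mul leqnn subnn.
  move=> /andP[_ x_neq]; have := ltn_ord x; rewrite ltnS => le_xk.
  rewrite expr0 !mulr1 -[_ ^+ _]mulr1 fps_coef_Xexp_mul le_xk.
  have lt_xk : (x < k)%N by rewrite ltn_neqAle le_xk andbT.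
  by rewrite fps_coef1 subn_eq0 (leqNgt k x) lt_xk mulr0.
under eq_bigr do rewrite /M mulrCA qphi.
have CS : C i.+1 = y i.+1 ^+ delta i / (1 - y i.+1) * C i.
  by rewrite /C (big_ord_recr i) (big_ord_recr i.+1) /= mulrACA mulrC.
by rewrite coef_geometric exprD /phi CS !mulrA.
Qed.

(** The words are distributed according to the permutation that sorts them; for
each permutation they become chains, counted by [sum_chains]. *)
Lemma carlitz :
  Fps (fun k => (\sum_(i < k.+1) q ^+ i) ^+ n.+1) * \prod_(i < n.+2) (1 - y i) =
  \sum_(s : 'S_n.+1) \prod_(i < n) y i.+1 ^+ descent s i.
Proof.
suff -> : Fps (fun k => (\sum_(i < k.+1) q ^+ i) ^+ n.+1) =
    (\sum_(s : 'S_n.+1) \prod_(i < n) y i.+1 ^+ descent s i) *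
    \prod_(i < n.+2) (1 - y i)^-1.
  rewrite -mulrA -big_split /= [X in _ * X]big1 ?mulr1 // => i _.
  by rewrite mulVr ?unit_1subXM.
apply: fpsP => k; rewrite mulr_suml fps_coef_sum [LHS]/=.
have -> : (\sum_(i < k.+1) q ^+ i) ^+ n.+1 =
    \sum_(f : {ffun 'I_n.+1 -> 'I_k.+1}) \prod_(i < n.+1) q ^+ f i.
  by rewrite -(bigA_distr_bigA (fun _ (j : 'I_k.+1) => q ^+ j)) prodr_const card_ord.
transitivity (\sum_(f : {ffun 'I_n.+1 -> 'I_k.+1}) \sum_(s : 'S_n.+1)
    (\prod_(i < n) (f (s (inord i.+1)) + descent s i <= f (s (inord i)))%N%:R) *
    \prod_(i < n.+1) q ^+ f i).
  by apply: eq_bigr => f _; rewrite -mulr_suml (sum_sorts R (fun i => f i)) mul1r.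
rewrite exchange_big; apply: eq_bigr => s _; rewrite -(sum_chains (descent s)).
(* The chain attached to f and s is f o s; the change of variable replaces f by
   that chain. *)
pose act (u : 'S_n.+1) (f : {ffun 'I_n.+1 -> 'I_k.+1}) := [ffun i => f (u i)].
have actK u : cancel (act u) (act u^-1%g).
  by move=> f; apply/ffunP=> i; rewrite !ffunE permKV.
rewrite (reindex (act s^-1%g)) /=; last first.
  exists (act s) => f _; last exact: actK.
  by have := actK s^-1%g f; rewrite invgK.
apply: eq_bigr => f _; rewrite big_split /= -mulrA; congr (_ * _).
  by apply: eq_bigr => i _; rewrite !ffunE !permK.
rewrite (reindex_inj (@perm_inj _ s)) /= big_ord_recr /= !ffunE permK.
congr (_ * _); apply: eq_bigr => i _; rewrite ffunE permK.
by congr (q ^+ f _); apply: val_inj; rewrite /= inordK // ltnS ltnW.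
Qed.

End Carlitz.

(** * Summation over the colors *)

Section Colors.
Variables (R : comNzRingType) (t q : R) (r n : nat).
Let y (i : nat) : R := t * q ^+ i.

(** For b < c the exponent runs over r - c, ..., r - 1, for b = c it is 0 or r, and
for b > c it runs over 1, ..., r - c - 1; together these are r consecutive
values, starting at 0 or at 1. *)
Lemma sum_cyclic_shift (x : R) (c : 'I_r) (delta : bool) :
  \sum_(b < r) x ^+ (r * ((b < c)%N || (b == c :> nat) && delta) + b - c) =
  x ^+ delta * \sum_(j < r) x ^+ j.
Proof.
have lt_cr := ltn_ord c; set m := val c in lt_cr *.
pose F b := x ^+ (r * ((b < m)%N || (b == m) && delta) + b - m).
rewrite -(big_mkord xpredT F) -(big_mkord xpredT (fun j => x ^+ j)).
rewrite (big_cat_nat (n := m)) ?(ltnW lt_cr) //= (big_cat_nat (n := m.+1) (m := m)) //=.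
rewrite big_nat1.
have -> : \sum_(0 <= b < m) F b = \sum_(r - m <= j < r) x ^+ j.
  rewrite -[(r - m)%N]add0n big_addn subKn 1?ltnW //.
  by apply: eq_big_nat => b /andP[_ lt_bm]; rewrite /F lt_bm; congr (x ^+ _); lia.
have -> : \sum_(m.+1 <= b < r) F b = \sum_(1 <= j < r - m) x ^+ j.
  rewrite -add1n big_addn; apply: eq_big_nat => b b_gt0; rewrite /F.
  have -> : (b + m < m)%N = false by lia.
  have -> : (b + m == m)%N = false by lia.
  by congr (x ^+ _); rewrite muln0; lia.
have -> : F m = x ^+ (r * delta).
  by rewrite /F ltnn eqxx /=; congr (x ^+ _); lia.
have -> : \sum_(r - m <= j < r) x ^+ j + (x ^+ (r * delta) + \sum_(1 <= j < r - m) x ^+ j) =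
    \sum_(1 <= j < r) x ^+ j + x ^+ (r * delta).
  rewrite [RHS]addrC [in RHS](big_cat_nat (n := (r - m)%N)) ?leq_subr ?subn_gt0 //=.
  by rewrite [LHS]addrC -addrA.
have r_gt0 : (0 < r)%N := leq_ltn_trans (leq0n m) lt_cr.
case: delta {F}; rewrite ?muln1 ?muln0.
  rewrite -big_nat_recr // big_add1 mulr_sumr.
  by apply: eq_bigr => j _; rewrite exprS.
by rewrite mul1r addrC [RHS]big_ltn.
Qed.

(** Summation by parts, for the weights 1 and i + 1.  The differences
[r * D i + c i - c i.+1] are given as [e i] to keep natural numbers free of
truncated subtraction. *)
Lemma abel_summation (D c e : nat -> nat) m :
    (forall i, (i < m)%N -> (e i + c i.+1 = r * D i + c i)%N) ->
  (\sum_(i < m) e i + c m = r * (\sum_(i < m) D i) + c 0)%N /\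
  (\sum_(i < m) i.+1 * e i + m.+1 * c m =
   r * (\sum_(i < m) D i * i.+1) + \sum_(i < m.+1) c i)%N.
Proof.
elim: m => [|m IHm] eE; first by rewrite !big_ord0 big_ord_recl big_ord0 /=; lia.
have [|IH1 IH2] := IHm; first by move=> i lt_im; apply: eE; apply: ltnW.
have eEm := eE m (ltnSn m); have := congr1 (muln m.+1) eEm.
rewrite !(big_ord_recr m) (big_ord_recr m.+1) /=.
move: (\sum_(i < m) e i)%N (\sum_(i < m) D i)%N IH1 => Se SD IH1.
move: (\sum_(i < m) i.+1 * e i)%N (\sum_(i < m) D i * i.+1)%N IH2 => Sie SDi IH2.
move: (\sum_(i < m.+1) c i)%N IH2 => Sc IH2.
by split; lia.
Qed.

Lemma mem_Des (c : {ffun 'I_n.+1 -> 'I_r}) (s : 'S_n.+1) (i : 'I_n) :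
  (i \in Des (c, s)) =
  (c (inord i) < c (inord i.+1))%N ||
  (c (inord i) == c (inord i.+1) :> nat) && descent s i.
Proof. by rewrite inE /cprec /entry /color /= ltnS [_ == c (inord i) :> nat]eq_sym. Qed.

(** The definitions of fdes and fmaj regrouped into a product of local weights, one
for each pair of neighbouring positions, as [sum_path] requires. *)
Lemma weight_colored_perm (c : {ffun 'I_n.+1 -> 'I_r}) (s : 'S_n.+1) :
  t ^+ fdes_Gamma (c, s) * q ^+ fmaj_Gamma (c, s) =
  (\prod_(i < n) y i.+1 ^+ (r * (i \in Des (c, s)) + c (inord i) - c (inord i.+1)))
  * y n.+1 ^+ c ord_max.
Proof.
pose C i : nat := c (inord i).
(* Extended by false from n on, to have a function on all naturals. *)
pose D i : nat := if insub i is Some j then (j : 'I_n) \in Des (c, s) else false.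
have DE (i : 'I_n) : D i = (i \in Des (c, s)) by rewrite /D valK.
pose e i := (r * D i + C i - C i.+1)%N.
have eE i : (i < n)%N -> (e i + C i.+1 = r * D i + C i)%N.
  move=> lt_in; rewrite subnK // (DE (Ordinal lt_in)) mem_Des /=.
  have := ltn_ord (c (inord i.+1)); rewrite /C.
  case: (ltnP (c (inord i))) => /= [_ lt_r|le_c _]; last first.
    by rewrite (leq_trans le_c) ?leq_addl.
  by rewrite muln1 (leq_trans (ltnW lt_r)) ?leq_addr.
have [sum_e sum_ie] := abel_summation eE.
have max_inord : inord n = ord_max :> 'I_n.+1 by apply: val_inj; rewrite /= inordK.
have ord0_inord : inord 0 = ord0 :> 'I_n.+1 by apply: val_inj; rewrite /= inordK.
have -> : fdes_Gamma (c, s) = (\sum_(i < n) e i + C n)%N.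
  rewrite sum_e /fdes_Gamma /color /C ord0_inord -sum1_card big_mkcond /=.
  by congr (r * _ + _)%N; apply: eq_bigr => i _; rewrite DE; case: (i \in _).
have -> : fmaj_Gamma (c, s) = (\sum_(i < n) i.+1 * e i + n.+1 * C n)%N.
  rewrite sum_ie /fmaj_Gamma big_mkcond /=.
  congr (r * _ + _)%N; apply: eq_bigr => i _.
    by rewrite DE; case: (i \in _); rewrite ?mul1n.
  by rewrite /color /C inord_val.
rewrite !exprD mulrACA exprM /C max_inord; congr (_ * _); last first.
  by rewrite exprMn exprS exprMn.
rewrite !expr_sum -big_split /=; apply: eq_bigr => i _.
by rewrite exprM -exprMn /e DE.
Qed.

(** By [sum_cyclic_shift], the sum over each color is independent of the next
color, so the collected weights [phi i] are constants and the sum factors. *)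
Lemma sum_colors (d : nat) (s : 'S_n.+1) : (d <= r)%N ->
  \sum_(c : {ffun 'I_n.+1 -> 'I_r} | (c ord_max < d)%N)
     t ^+ fdes_Gamma (c, s) * q ^+ fmaj_Gamma (c, s) =
  (\prod_(i < n) y i.+1 ^+ descent s i) *
  ((\prod_(i < n) \sum_(j < r) y i.+1 ^+ j) * \sum_(j < d) y n.+1 ^+ j).
Proof.
move=> le_dr.
pose M i (b c : 'I_r) :=
  y i.+1 ^+ (r * ((b < c)%N || (b == c :> nat) && descent s i) + b - c).
pose phi i (_ : 'I_r) :=
  \prod_(j < i) (y j.+1 ^+ descent s j * \sum_(l < r) y j.+1 ^+ l).
pose w (c : 'I_r) := if (c < d)%N then y n.+1 ^+ c else 0.
transitivity (\sum_(f : {ffun 'I_n.+1 -> 'I_r})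
     (\prod_(i < n) M i (f (inord i)) (f (inord i.+1))) * w (f ord_max)).
  rewrite big_mkcond; apply: eq_bigr => c _; rewrite /w.
  case: ifP => _; last by rewrite mulr0.
  by rewrite weight_colored_perm; under eq_bigr do rewrite mem_Des.
rewrite (sum_path (phi := phi)) => [|b|i c _]; last 2 first.
- by rewrite /phi big_ord0.
- by rewrite -mulr_sumr sum_cyclic_shift /phi big_ord_recr.
rewrite -mulr_sumr /phi big_split /= -mulrA; congr (_ * (_ * _)).
by rewrite -big_mkcond /= (big_ord_widen r (fun j => y n.+1 ^+ j) le_dr).
Qed.

End Colors.

Theorem theorem11p2 (r p n : nat) (r_gt0 : (0 < r)%N) (p_gt0 : (0 < p)%N)
    (p_dvd_r : (p %| r)%N) :
  let d := (r %/ p)%N in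
  (Fps (fun k => qint k.+1 ^+ n.+1) : fps2) =
  (\sum_(h in Grpn r p n) fps_t ^+ fdes p h * fps_q ^+ fmaj p h) /
  ((1 - fps_t) *
   \prod_(1 <= i < n.+1) (1 - fps_t ^+ r * fps_q ^+ (i * r)) *
   (1 - fps_t ^+ d * fps_q ^+ (n.+1 * d))).
Proof.
move=> d.
have d_gt0 : (0 < d)%N by rewrite divn_gt0 // dvdn_leq.
have le_dr : (d <= r)%N := leq_div r p.
(* Only an equation is kept for y, so that conversion cannot unfold it into
   coefficient sequences. *)
have [y y_def] : exists y : nat -> fps2, y = fun i => fps_t * fps_q ^+ i.
  by exists (fun i => fps_t * fps_q ^+ i).
have yE i : y i = fps_t * fps_q ^+ i by rewrite y_def.
have yX i m : fps_t ^+ m * fps_q ^+ (i * m) = y i ^+ m.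
  by rewrite yE exprMn exprM.
have unit_1suby i : 1 - y i \is a GRing.unit.
  by rewrite yE; exact: unit_1subXM.
have unit_1subyX i m : (0 < m)%N -> 1 - y i ^+ m \is a GRing.unit.
  by case: m => // m _; rewrite exprS yE -mulrA; exact: unit_1subXM.
have geo i m : 1 - y i ^+ m = (1 - y i) * \sum_(j < m) y i ^+ j.
  rewrite -[1 in LHS](expr1n _ m) subrXX; congr (_ * _).
  by apply: eq_bigr => j _; rewrite expr1n mul1r.
have carl : (Fps (fun k => qint k.+1 ^+ n.+1) : fps2) * \prod_(i < n.+2) (1 - y i) =
    \sum_(s : 'S_n.+1) \prod_(i < n) y i.+1 ^+ descent s i.
  by rewrite y_def; exact: carlitz.
have num : \sum_(h in Grpn r p n) fps_t ^+ fdes p h * fps_q ^+ fmaj p h =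
    (\sum_(s : 'S_n.+1) \prod_(i < n) y i.+1 ^+ descent s i) *
    ((\prod_(i < n) \sum_(j < r) y i.+1 ^+ j) * \sum_(j < d) y n.+1 ^+ j).
  transitivity (\sum_(g in Gamma r p n) fps_t ^+ fdes_Gamma g * fps_q ^+ fmaj_Gamma g).
    by rewrite -(phi_Grpn n p_gt0 p_dvd_r) [RHS]big_imset; last exact: phi_inj.
  rewrite mulr_suml.
  transitivity (\sum_(s : 'S_n.+1) \sum_(c : {ffun 'I_n.+1 -> 'I_r} | (c ord_max < d)%N)
     fps_t ^+ fdes_Gamma (c, s) * fps_q ^+ fmaj_Gamma (c, s)).
    rewrite exchange_big pair_big_dep /=; apply: eq_big => [[c s]|[c s] _] //.
    by rewrite inE andbT.
  by apply: eq_bigr => s _; rewrite y_def; exact: sum_colors.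
have prodE : \prod_(1 <= i < n.+1) (1 - fps_t ^+ r * fps_q ^+ (i * r)) =
    \prod_(i < n) (1 - y i.+1 ^+ r).
  by rewrite big_add1 big_mkord; apply: eq_bigr => i _; rewrite yX.
have tE : fps_t = y 0%N by rewrite yE mulr1.
have den_unit :
    (1 - y 0%N) * \prod_(i < n) (1 - y i.+1 ^+ r) * (1 - y n.+1 ^+ d) \is a GRing.unit.
  rewrite !unitrM unit_1suby unit_1subyX // andbT /=.
  by apply: rpred_prod => i _; apply: unit_1subyX.
rewrite prodE yX num [in 1 - fps_t]tE -carl; apply: canRL (mulrK den_unit) _.
rewrite -[RHS]mulrA; congr (_ * _).
under eq_bigr do rewrite geo.
rewrite geo big_split [in RHS]big_ord_recl [in RHS]big_ord_recr /= -!mulrA.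
by rewrite [X in _ * (_ * X) = _]mulrCA.
Qed.
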